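(* Let $\mathcal{S}$ be a primitive recognizable substitution of constant length $K>1$ on a finite alphabet $\mathcal{A}$, with canonical isomorphism $\Phi:(\Sigma,\sigma,\mu)\to([0,1],\mathfrak{F},m)$, where $\mathfrak{F}$ is the corresponding infinite interval exchange transformation and $m$ is Lebesgue measure. Then $\lim_{n\to\infty}\mathfrak{F}^{K^n}(x)=x$ for almost every $x\in[0,1]$ if and only if $\mathcal{S}$ has a coincidence.
   Context: A substitution has constant length $K$ if $|\mathcal{S}(\alpha)|=K$ for all $\alpha\in\mathcal{A}$; then the Perron–Frobenius eigenvalue $\lambda$ below equals $K$. A substitution is primitive if some power of its substitution matrix has all entries positive. A substitution $\mathcal{S}$ of constant length $K>1$ has a coincidence if there are $N\in\mathbb{N}$, $\beta\in\mathcal{A}$ and $j_c\in\{0,\dots,K^N-1\}$ such that $\mathcal{S}^N(\alpha)(j_c)=\beta$ for all $\alpha\in\mathcal{A}$ (letters of a word are indexed starting from $0$). $\mathfrak{F}^{j}$ denotes the $j$-th iterate of $\mathfrak{F}$, defined almost everywhere. **Substitutions.** A substitution $\mathcal{S}$ on a finite alphabet $\mathcal{A}$ assigns to each $\alpha\in\mathcal{A}$ a nonempty finite word $\mathcal{S}(\alpha)=\mathcal{S}(\alpha)(0)\,\mathcal{S}(\alpha)(1)\cdots\mathcal{S}(\alpha)(|\mathcal{S}(\alpha)|-1)$ over $\mathcal{A}$; it extends to words by concatenation, which defines $\mathcal{S}^n(\alpha)$. Let $\mathcal{L}$ be the set of all subwords of all words $\mathcal{S}^n(\alpha)$, and let $\Sigma\subset\mathcal{A}^{\mathbb{Z}}$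 (product topology) be the set of bi-infinite sequences all of whose finite subwords lie in $\mathcal{L}$. The shift is $(\sigma(\tau))(k)=\tau(k+1)$. For $\tau\in\Sigma$, $\mathcal{S}(\tau)=\cdots\mathcal{S}(\tau(-1))\mathcal{S}(\tau(0))\mathcal{S}(\tau(1))\cdots$ with $\mathcal{S}(\tau(0))$ starting at coordinate $0$. $\mathcal{S}$ is recognizable if for every $\tau\in\Sigma$ there are a unique $\tau'\in\Sigma$ and $0\le k\le|\mathcal{S}(\tau'(0))|-1$ with $\tau=\sigma^k(\mathcal{S}(\tau'))$. Write $[\alpha]=\{\tau\in\Sigma:\tau(0)=\alpha\}$. The substitution matrix $M$ has entry $M_{\alpha\beta}$ equal to the number of occurrences of $\alpha$ in $\mathcal{S}(\beta)$; $\lambda$ is its Perron–Frobenius eigenvalue. **Measure.** $\mu$ is the $\sigma$-invariant Borel probability measure on $\Sigma$ (unique since $\mathcal{S}$ is primitive); it satisfies $\mu([\alpha])>0$ and $\mu(\mathcal{S}^n([\alpha]))=\mu([\alpha])/\lambda^n$ for all $\alpha\in\mathcal{A}$, $n\ge0$. **Addresses.** Let $\mathsf{A}=\{(\alpha,j):\alpha\in\mathcal{A},\ 0\le j\le|\mathcal{S}(\alpha)|-1\}$ and, for $\alpha\in\mathcal{A}$, $\mathsf{T}(\alpha)=\{(\beta,j)\in\mathsf{A}:\mathcal{S}(\beta)(j)=\alpha\}$. An address is a finite or infinite sequence $((\alpha_1,j_1),(\alpha_2,j_2),\dots)$ in $\mathsf{A}$ with $(\alpha_k,j_k)\in\mathsf{T}(\alpha_{k-1})$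 for all $k>1$; $\mathbf{A}_n$ is the set of addresses of length $n$. For $\tau\in\Sigma$, recognizability gives a unique sequence $\tau^{(0)}=\tau,\tau^{(1)},\tau^{(2)},\dots$ in $\Sigma$ and integers $j_n$ with $\tau^{(n-1)}=\sigma^{j_n}(\mathcal{S}(\tau^{(n)}))$, $0\le j_n<|\mathcal{S}(\tau^{(n)}(0))|$; the address of $\tau$ is $\mathbf{a}(\tau)=((\alpha_n,j_n))_{n\ge1}$ with $\alpha_n=\tau^{(n)}(0)$. **Canonical isomorphism.** Choose $\Phi_0:\mathcal{A}\to[0,1)$ so that the intervals $[\Phi_0(\alpha),\Phi_0(\alpha)+\mu([\alpha]))$, $\alpha\in\mathcal{A}$, partition $[0,1)$. For each $\alpha\in\mathcal{A}$ choose an ordering of $\mathsf{T}(\alpha)$ and let $\phi:\mathsf{T}(\alpha)\to[0,\mu([\alpha]))$ give the left endpoints of the partition, in that order, of $[0,\mu([\alpha]))$ into intervals $[\phi(\beta,j),\phi(\beta,j)+\mu([\beta])/\lambda)$, $(\beta,j)\in\mathsf{T}(\alpha)$. (Since the sets $\mathsf{T}(\alpha)$ partition $\mathsf{A}$, this defines $\phi$ on $\mathsf{A}$.) For $\mathbf{a}=((\alpha_1,j_1),\dots,(\alpha_n,j_n))\in\mathbf{A}_n$ put $$\Phi_n(\mathbf{a})=\Phi_0(\mathcal{S}(\alpha_1)(j_1))+\sum_{k=1}^n\frac{\phi(\alpha_k,j_k)}{\lambda^{k-1}},\qquad \mathbf{I}(\mathbf{a})=\Big[\Phi_n(\mathbf{a}),\Phi_n(\mathbf{a})+\frac{\mu([\alpha_n])}{\lambda^n}\Big).$$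 For each $n$ the intervals $\mathbf{I}(\mathbf{a})$, $\mathbf{a}\in\mathbf{A}_n$, partition $[0,1)$, and these partitions are successively refining. The canonical isomorphism given by these (arbitrary) choices is $\Phi(\tau)=\lim_{n\to\infty}\Phi_n(\mathbf{a}_n(\tau))$, where $\mathbf{a}_n(\tau)$ is the length-$n$ prefix of $\mathbf{a}(\tau)$. **The map $\mathfrak{F}$.** For an address $\mathbf{a}=((\alpha_k,j_k))_k$ let $\mathbf{n}(\mathbf{a})$ be the smallest $k$ with $j_k<|\mathcal{S}(\alpha_k)|-1$ ($\infty$ if there is none). If $\mathbf{n}(\mathbf{a})=N<\infty$, define $\mathcal{V}(\mathbf{a})$ by replacing $(\alpha_N,j_N)$ with $(\alpha_N,j_N+1)$, replacing the first $N-1$ entries by the unique address $((\beta_1,0),\dots,(\beta_{N-1},0))$ with $\beta_{N-1}=\mathcal{S}(\alpha_N)(j_N+1)$ and $\beta_{k-1}=\mathcal{S}(\beta_k)(0)$, and leaving all entries of index $>N$ unchanged. For $x\in[0,1)$ let $\mathbf{a}(x)$ be the infinite address whose length-$n$ prefix $\mathbf{a}_n(x)$ is, for each $n$, the unique element of $\mathbf{A}_n$ with $x\in\mathbf{I}(\mathbf{a}_n(x))$, and let $\mathbf{n}(x)=\mathbf{n}(\mathbf{a}(x))$. For $x$ with $\mathbf{n}(x)=N<\infty$ (which holds for a.e. $x$) the infinite interval exchange transformation is $$\mathfrak{F}(x)=x-\Phi_N(\mathbf{a}_N(x))+\Phi_N(\mathcal{V}(\mathbf{a}_N(x))).$$ 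*)

(* Defs.v *)
From HB Require Import structures.
From mathcomp Require Import all_boot all_order all_algebra.
From mathcomp Require Import complex.
From mathcomp Require Import all_classical all_reals all_analysis.

Set Implicit Arguments.
Unset Strict Implicit.
Unset Printing Implicit Defensive.

Import Order.TTheory GRing.Theory Num.Theory.
Import numFieldNormedType.Exports.

Local Open Scope classical_set_scope.
Local Open Scope ring_scope.

Section Substitution.
Context {A : finType}.
Implicit Types (S : A -> seq A) (w : seq A).

Definition subst_word S w : seq A := flatten (map S w).

(* S^n(a) *)
Definition subst_iter S (n : nat) (a : A) : seq A :=
  iter n (subst_word S) [:: a].

Definition constant_length S (K : nat) : Prop := forall a, size (S a) = K.

Definition subst_matrix S : 'M[nat]_#|A| :=
  \matrix_(i, j) count_mem (enum_val i) (S (enum_val j)).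

Definition primitive S : Prop :=
  exists2 n, (0 < n)%N & forall i j, (0 < (subst_matrix S ^+ n) i j)%N.

(* [nth a _ jc] has a default value, but for a substitution of constant
   length K the index jc < K ^ N is always within the word S^N(a). *)
Definition has_coincidence S (K : nat) : Prop :=
  exists (N : nat) (b : A) (jc : nat),
    (jc < K ^ N)%N /\ forall a, nth a (subst_iter S N a) jc = b.

Definition language S : set (seq A) :=
  [set w | exists a n, infix w (subst_iter S n a)].

(* A^Z with the product of the discrete topologies *)
Definition full_shift : Type := {ptws int -> discrete_topology A}.
HB.instance Definition _ := Topological.on full_shift.

Definition shift (t : full_shift) : full_shift := fun k => t (k + 1).

Definition factor (t : full_shift) (i : int) (n : nat) : seq A :=
  mkseq (fun k => t (i + k%:Z)) n.

Definition subshift S : set full_shift :=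
  [set t | forall i n, language S (factor t i n)].

(* The bi-infinite word ... S(t(-1)) . S(t(0)) S(t(1)) ... : as the words S(a)
   are nonempty, coordinate n >= 0 is letter n of S(t(0)) ... S(t(n)), and
   coordinate -(n+1) is letter n, read from the right, of
   S(t(-(n+1))) ... S(t(-1)). *)
Definition subst_seq S (t : full_shift) : full_shift := fun k =>
  match k with
  | Posz n => nth (t 0) (subst_word S (factor t 0 n.+1)) n
  | Negz n => nth (t 0) (rev (subst_word S (factor t (Negz n) n.+1))) n
  end.

Definition recognizable S : Prop :=
  forall t, subshift S t ->
    exists! p : full_shift * nat,
      [/\ subshift S p.1, (p.2 < size (S (p.1 0)))%N
        & t = iter p.2 shift (subst_seq S p.1)].

Lemma subshift_shift S (t : full_shift) : subshift S t -> subshift S (shift t).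
Proof.
move=> St i n; have := St (i + 1) n; rewrite /factor.
by under eq_mkseq => k do rewrite addrAC.
Qed.

Definition subshift_type S : Type := set_type (subshift S).
HB.instance Definition _ S := Topological.on (subshift_type S).

Definition subshift_map S (t : subshift_type S) : subshift_type S :=
  exist _ (shift (set_val t)) (mem_set (subshift_shift (set_mem (valP t)))).

(* The subshift with its Borel sigma-algebra. Measurable types of the library
   are pointed; t0 only provides the point. *)
Definition pointed_subshift S (t0 : subshift_type S) : Type := subshift_type S.
HB.instance Definition _ S (t0 : subshift_type S) :=
  Topological.on (pointed_subshift t0).
HB.instance Definition _ S (t0 : subshift_type S) :=
  isPointed.Build (pointed_subshift t0) t0.

Definition borel_subshift S (t0 : subshift_type S) :=
  g_sigma_algebraType (@open (pointed_subshift t0)).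

(* Addresses. A pair (a, j) stands for the address letter (alpha, j); the n-th
   entry (n >= 1) of an infinite address a : nat -> A * nat is a n.-1. *)

(* p \in T(a) *)
Definition parent_of S (a : A) (p : A * nat) : bool :=
  (p.2 < size (S p.1))%N && (nth p.1 (S p.1) p.2 == a).

(* s is a finite address *)
Definition is_address S (s : seq (A * nat)) : bool :=
  all (fun p => p.2 < size (S p.1))%N s
  && sorted (fun p q => parent_of S p.1 q) s.

Definition address_of_seq S (t : full_shift) (a : nat -> A * nat) : Prop :=
  exists u : nat -> full_shift,
    [/\ u 0%N = t, (forall n, subshift S (u n)) &
      forall n, [/\ (a n).1 = u n.+1 0, ((a n).2 < size (S (a n).1))%N
                  & u n = iter (a n).2 shift (subst_seq S (u n.+1))]].

Definition not_last S (p : A * nat) : bool := (p.2 < (size (S p.1)).-1)%N.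

(* the address ((b_1, 0), ..., (b_m, 0)) with b_m = b and b_(k-1) = S(b_k)(0) *)
Definition zero_address S (b : A) (m : nat) : seq (A * nat) :=
  rev [seq (c, 0%N) | c <- traject (fun c => head c (S c)) b m].

(* The map V, on finite addresses; the junk value s is taken when n(s) is
   infinite. *)
Definition adic_succ S (s : seq (A * nat)) : seq (A * nat) :=
  let m := find (not_last S) s in
  match drop m s with
  | p :: s' =>
      zero_address S (nth p.1 (S p.1) p.2.+1) m ++ (p.1, p.2.+1) :: s'
  | [::] => s
  end.

(* n(a) = N *)
Definition first_not_last S (a : nat -> A * nat) (N : nat) : Prop :=
  [/\ (0 < N)%N, not_last S (a N.-1) & forall k, (k < N.-1)%N -> ~~ not_last S (a k)].

End Substitution.

Arguments full_shift A : clear implicits.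

(* lambda is the dominant eigenvalue of the substitution matrix *)
Definition perron_frobenius_eigenvalue (R : realType) (A : finType)
    (S : A -> seq A) (lambda : R) : Prop :=
  eigenvalue (map_mx (fun n : nat => n%:R : R) (subst_matrix S)) lambda /\
  forall z : R[i],
    eigenvalue (map_mx (fun n : nat => n%:R : R[i]) (subst_matrix S)) z ->
    `|z| <= lambda%:C%C.

Definition shift_invariant (R : realType) (A : finType) (S : A -> seq A)
    (t0 : subshift_type S) (mu : probability (borel_subshift t0) R) : Prop :=
  forall E : set (borel_subshift t0), measurable E ->
    mu (@subshift_map A S @^-1` E) = mu E.

(* mu([a]), as a real number *)
Definition letter_measure (R : realType) (A : finType) (S : A -> seq A)
    (t0 : subshift_type S) (mu : probability (borel_subshift t0) R)
    (a : A) : R :=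
  fine (mu [set t : borel_subshift t0 | set_val t 0 = a]).

(* In this section w a stands for mu([a]). *)
Section CanonicalIsomorphism.
Context {R : realType} {A : finType}.
Variables (S : A -> seq A) (lambda : R) (w : A -> R).
Variables (Phi0 : A -> R) (phi : A * nat -> R).

Definition initial_choice : Prop :=
  classical_sets.partition [set: A]
    (fun a => `[Phi0 a, Phi0 a + w a[%classic) `[0, 1[%classic.

(* ordT a lists T(a) in the chosen order *)
Definition parent_choice (ordT : A -> seq (A * nat)) : Prop :=
  forall a,
    [/\ uniq (ordT a), ordT a =i parent_of S a,
        sorted (fun p q => phi p < phi q) (ordT a) &
        classical_sets.partition [set p | parent_of S a p]
          (fun p => `[phi p, phi p + w p.1 / lambda[%classic)
          `[0, w a[%classic].

(* Phi_n and the interval I, for addresses of length n >= 1 (junk at [::]) *)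
Definition Phi_fin (s : seq (A * nat)) : R :=
  match s with
  | [::] => 0
  | p :: _ => Phi0 (nth p.1 (S p.1) p.2)
              + \sum_(k < size s) phi (nth p s k) / lambda ^+ k
  end.

Definition address_interval (s : seq (A * nat)) : set R :=
  match s with
  | [::] => set0
  | p :: s' =>
      `[Phi_fin s, Phi_fin s + w (last p s').1 / lambda ^+ size s[%classic
  end.

Definition canonical_isomorphism (Phi : subshift_type S -> R) : Prop :=
  forall t a, address_of_seq S (set_val t) a ->
    (fun n => Phi_fin (mkseq a n)) @ \oo --> Phi t.

(* a is the infinite address of the point x *)
Definition address_of_point (x : R) (a : nat -> A * nat) : Prop :=
  forall n, (0 < n)%N ->
    is_address S (mkseq a n) /\ address_interval (mkseq a n) x.

(* The infinite interval exchange is only defined almost everywhere: the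
   values of F where n(x) is infinite, and outside [0, 1[, are arbitrary. *)
Definition infinite_iet (F : R -> R) : Prop :=
  forall x a N, x \in `[0, 1[ -> address_of_point x a ->
    first_not_last S a N ->
    F x = x - Phi_fin (mkseq a N) + Phi_fin (adic_succ S (mkseq a N)).

End CanonicalIsomorphism.

(* Main.v *)
Require Import Defs.
From mathcomp Require Import all_boot all_order all_algebra.
From mathcomp Require Import all_classical all_reals all_analysis.
From mathcomp Require Import zify ring lra.

Set Implicit Arguments.
Unset Strict Implicit.
Unset Printing Implicit Defensive.

Import Order.TTheory GRing.Theory Num.Theory.
Import numFieldNormedType.Exports.

Local Open Scope classical_set_scope.
Local Open Scope ring_scope.

(** Write w for the letter measures. The two partition hypotheses say
that [0, 1[ is cut into Rokhlin towers. At level n there is one tower for each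
letter b: it has K ^ n floors, numbered by the position P in the word S^n(b),
and all its floors have length w b / lambda ^ n. The tower of b at level n + 1
is obtained by cutting and stacking: its block of floors numbered
j K^n, ..., (j + 1) K^n - 1 is a vertical slice of the level n tower of the
letter S(b)(j). Comparing total lengths gives lambda = K. The map F is built so
that on every floor but the top one of any tower it is the translation to the
next floor ([iet_tower_level]). Hence, as soon as x lies in a tower with at
least K^n floors above it, F^(K^n) moves x up by K^n floors. In terms of
level n, this preserves the height of x in its level n tower and replaces the
letter of that tower by the next letter of a word of the language.

Assume a coincidence: the letter of S^N(a) at position jc is c for every a.
If the base-K digits m, ..., m + N - 1 of the height of x spell jc, then x is
in the level m tower of c, and so is F^(K^n) x for every n >= m + N, on the
same floor, because F^(K^n) keeps the n lowest digits. So the two points are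
within w c / K^m of each other ([window_same_level]). Under Lebesgue measure the
digits are independent and uniform, so that almost every x meets such windows
for infinitely many m ([negligible_no_window]), which gives the convergence.

Conversely, choose by primitivity a word S^m(b0) containing every letter.
Without a coincidence, for every n and every r < K^n the letter at position r
of S^n(a) is not the same for all the letters a; so it differs for some pair
of consecutive letters of S^m(b0) ([no_coincidence_pair]). Collecting, over r,
the corresponding floors of the level m + n tower of b0 gives a set U n whose
measure w b0 / K^m does not depend on n, and on which F^(K^n) changes the
initial letter ([iet_power_letters]). The limsup of the sets U n has positive
measure, and convergence fails at each of its points that is not an endpoint
of the initial partition ([ae_cvg_coincidence]). *)

(** * Words of the substitution *)

Section Words.
Variables (A : finType) (S : A -> seq A).
Local Open Scope nat_scope.

Lemma iter_subst_word_cat n (u v : seq A) :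
  iter n (subst_word S) (u ++ v) =
  iter n (subst_word S) u ++ iter n (subst_word S) v.
Proof. by elim: n => //= n ->; rewrite /subst_word map_cat flatten_cat. Qed.

Lemma iter_subst_word n (u : seq A) :
  iter n (subst_word S) u = flatten [seq subst_iter S n a | a <- u].
Proof.
elim: u => [|a u IHu] /=; first by elim: n => //= n ->.
by rewrite -cat1s iter_subst_word_cat IHu.
Qed.

Lemma subst_iterS n b :
  subst_iter S n.+1 b = flatten [seq subst_iter S n a | a <- S b].
Proof.
by rewrite /subst_iter iterSr -iter_subst_word /subst_word /= cats0.
Qed.

(** The (i, j) entry of the n-th power of the matrix counts the occurrences of
letter i in S^n(j); a positive entry is an occurrence. *)
Lemma mem_subst_iter_matrix n (i j : 'I_#|A|) :
  (0 < (subst_matrix S ^+ n)%R i j) ->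
  enum_val i \in subst_iter S n (enum_val j).
Proof.
elim: n i j => [|n IHn] i j.
  rewrite expr0 mxE; case: eqP => [->|] //= _.
  by rewrite inE.
rewrite exprSr mxE lt0n => sum_neq0.
have [k] : exists k : 'I_#|A|,
    (subst_matrix S ^+ n)%R i k * subst_matrix S k j != 0.
  apply/existsP; apply: contraNT sum_neq0 => /existsPn h.
  by apply/eqP; apply: big1 => k _; apply/eqP; move: (h k); rewrite negbK.
rewrite muln_eq0 negb_or => /andP[ik kj].
rewrite subst_iterS; apply/flatten_mapP; exists (enum_val k).
  by move: kj; rewrite mxE -lt0n -has_count has_pred1.
by apply: IHn; rewrite lt0n.
Qed.

Lemma primitive_word b : primitive S ->
  exists m, forall a, a \in subst_iter S m b.
Proof.
case=> m _ m_gt0; exists m => a.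
by rewrite -(enum_rankK a) -(enum_rankK b); exact: mem_subst_iter_matrix.
Qed.

End Words.

Lemma nth_flatten_map (T U : Type) (x : U) (y : T) (f : T -> seq U) k
    (s : seq T) i :
  (forall t, size (f t) = k) -> (i < size s * k)%N ->
  nth x (flatten (map f s)) i = nth x (f (nth y s (i %/ k))) (i %% k).
Proof.
move=> fk; elim: s i => [|t s IHs] i //=.
rewrite mulSn nth_cat fk => i_lt; case: ltnP => [ik|ki].
  by rewrite divn_small// modn_small.
have k_gt0 : (0 < k)%N by case: (k) ki i_lt => //; rewrite muln0.
by rewrite IHs ?ltn_subLR// -{3 4}(subnK ki) divnDr// divnn k_gt0 addn1 modnDr.
Qed.

(** * Positions and addresses *)

Section Towers.
Variables (A : finType) (S : A -> seq A) (K : nat).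
Hypotheses (K_gt1 : (1 < K)%N) (SK : constant_length S K).
Local Open Scope nat_scope.

Definition child (p : A * nat) : A := nth p.1 (S p.1) p.2.

(** The letter of S^n(b) at position P, computed by reading P in base K from
its leading digit down. With this recursion letters, addresses and endpoints
of intervals are all cut at the same place, and can be compared by a plain
induction on n. *)
Fixpoint letter n (b : A) (P : nat) : A :=
  if n is n'.+1 then letter n' (child (b, P %/ K ^ n')) (P %% K ^ n') else b.

(** The address of length n of the points on floor P of the level n tower of b;
its digits are those of P, lowest first. *)
Fixpoint tower_address n (b : A) (P : nat) : seq (A * nat) :=
  if n is n'.+1 then
    rcons (tower_address n' (child (b, P %/ K ^ n')) (P %% K ^ n'))
          (b, P %/ K ^ n')
  else [::].

Let K_gt0 : 0 < K. Proof. exact: ltnW. Qed.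

Let expK_gt0 n : 0 < K ^ n. Proof. by rewrite expn_gt0 K_gt0. Qed.
Hint Resolve K_gt0 expK_gt0 : core.

Lemma top_digit_lt n P : P < K ^ n.+1 -> P %/ K ^ n < K.
Proof. by rewrite expnS ltn_divLR. Qed.

Lemma size_subst_iter n b : size (subst_iter S n b) = K ^ n.
Proof.
elim: n b => [|n IHn] b //.
rewrite subst_iterS size_flatten /shape -map_comp (eq_map IHn).
by rewrite sumnE big_map big_const_seq count_predT SK iter_addn_0 expnS mulnC.
Qed.

Lemma nth_subst_iter x n b P : P < K ^ n ->
  nth x (subst_iter S n b) P = letter n b P.
Proof.
elim: n b P => [|n IHn] b P; first by rewrite expn0 ltnS leqn0 => /eqP ->.
move=> P_lt; rewrite subst_iterS (nth_flatten_map x b (size_subst_iter n)).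
  by rewrite IHn ?ltn_mod.
by rewrite SK -expnS.
Qed.

Lemma letterS n b P :
  letter n.+1 b P = letter n (child (b, P %/ K ^ n)) (P %% K ^ n).
Proof. by []. Qed.

Lemma tower_addressS n b P :
  tower_address n.+1 b P =
  rcons (tower_address n (child (b, P %/ K ^ n)) (P %% K ^ n)) (b, P %/ K ^ n).
Proof. by []. Qed.

Lemma size_tower_address n b P : size (tower_address n b P) = n.
Proof. by elim: n b P => // n IHn b P; rewrite tower_addressS size_rcons IHn. Qed.

Lemma zero_address_tower n b : zero_address S b n = tower_address n b 0.
Proof.
rewrite /zero_address; elim: n b => [|n IHn] b //.
by rewrite tower_addressS div0n mod0n -IHn /= rev_cons.
Qed.

(** On the top floor all the digits are equal to K - 1, which is the case where
the adic successor has to carry through the whole address. *)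
Lemma all_last_tower_address n b P : P.+1 = K ^ n ->
  all (fun p => ~~ not_last S p) (tower_address n b P).
Proof.
elim: n b P => [|n IHn] b P // PK.
have [dK mK] : P %/ K ^ n = K.-1 /\ (P %% K ^ n).+1 = K ^ n.
  have -> : P = K.-1 * K ^ n + (K ^ n).-1.
    by apply: succn_inj; rewrite PK expnS -addnS prednK// -mulSnr prednK.
  rewrite divnMDl// modnMDl divn_small ?modn_small ?prednK ?addn0 //.
by rewrite tower_addressS all_rcons IHn// andbT /not_last /= SK dK ltnn.
Qed.

Lemma adic_succ_all_last s b j :
  all (fun p => ~~ not_last S p) s -> not_last S (b, j) ->
  adic_succ S (rcons s (b, j)) =
  rcons (zero_address S (child (b, j.+1)) (size s)) (b, j.+1).
Proof.
move=> s_last bj; rewrite /adic_succ -cats1 find_cat.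
rewrite (negbTE (_ : ~~ has _ _)) ?has_predC -?all_predC//=.
by rewrite bj addn0 drop_size_cat// cats1.
Qed.

Lemma adic_succ_tower_address b j n : j.+1 < K ->
  adic_succ S (tower_address n.+1 b (j * K ^ n + (K ^ n).-1)) =
  tower_address n.+1 b (j.+1 * K ^ n).
Proof.
move=> jK; have lt1 : (K ^ n).-1 < K ^ n by rewrite ltn_predL.
rewrite !tower_addressS divnMDl// modnMDl divn_small// modn_small// addn0.
rewrite mulnK// modnMl adic_succ_all_last; first 1 last.
- by apply: all_last_tower_address; rewrite prednK.
- by rewrite /not_last /= SK -ltnS prednK.
by rewrite size_tower_address zero_address_tower.
Qed.

(** If S^n(a) has the same letter at position r for any two consecutive letters
a of S^m(b0), then it has the same letter at position r for all the letters of
S^m(b0), that is, for the whole alphabet. *)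
Lemma no_coincidence_pair m b0 n r :
  (forall a, a \in subst_iter S m b0) -> ~ has_coincidence S K -> r < K ^ n ->
  exists2 P, P.+1 < K ^ m &
    letter n (letter m b0 P) r <> letter n (letter m b0 P.+1) r.
Proof.
move=> b0m no_coin rK; apply: contrapT => same; apply: no_coin.
exists n, (letter n (letter m b0 0) r), r; split => // a.
rewrite nth_subst_iter//.
have /(nthP a)[P] := b0m a; rewrite size_subst_iter => PK <-.
rewrite nth_subst_iter//; elim: P PK => // P IHP PK; rewrite -IHP 1?ltnW//.
apply: contrapT => neq; apply: same; exists P => // eq.
by apply: neq; rewrite eq.
Qed.

End Towers.

(** * Measure *)

Lemma measure_bigsetU_seq_le d (T : measurableType d) (R : realType)
    (mu : {measure set T -> \bar R}) (I : Type) (s : seq I) (F : I -> set T) :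
  (forall i, measurable (F i)) ->
  (mu (\big[setU/set0]_(i <- s) F i) <= \sum_(i <- s) mu (F i))%E.
Proof.
move=> mF; elim: s => [|i s IHs]; first by rewrite !big_nil measure0.
rewrite !big_cons; apply: le_trans (leeD2l _ IHs).
by apply: measureU2 => //; exact: bigsetU_measurable.
Qed.

(** Sets whose measure stays above c overlap infinitely often on a set of
measure at least c: the tails of the union decrease, and each contains one of
the sets. *)
Lemma lim_sup_set_ge d (T : measurableType d) (R : realType)
    (mu : {measure set T -> \bar R}) (U : (set T)^nat) (c : \bar R) :
  (forall n, measurable (U n)) -> (mu (\bigcup_(k >= 0) U k) < +oo)%E ->
  (forall n, (c <= mu (U n))%E) -> (c <= mu (lim_sup_set U))%E.
Proof.
move=> mU Ufin cU; have cvgU := lim_sup_set_cvg mu U mU Ufin.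
rewrite -(cvg_lim _ cvgU)//; apply: lime_ge.
  by apply/cvg_ex; eexists; exact: cvgU.
apply: nearW => n; apply: le_trans (cU n) _.
apply: le_measure; rewrite ?inE//; first exact: bigcup_measurable.
by move=> x xU; exists n => /=.
Qed.

Section HalfOpenIntervals.
Variable R : realType.
Let mu := @lebesgue_measure R.

Lemma lebesgue_measure_co (a c : R) : 0 <= c ->
  mu `[a, a + c[%classic = c%:E.
Proof.
move=> c0; rewrite /mu lebesgue_measure_itv /= lte_fin ltrDl.
case: ltgtP c0 => // [c0 _|<- _]; last by [].
by rewrite -EFinB addrAC subrr add0r.
Qed.

Lemma partition_width_sum (T : choiceType) (D : set T) (s : seq T)
    (f g : T -> R) (c : R) :
  uniq s -> D = [set` s] -> 0 <= c -> (forall i, i \in s -> 0 <= g i) ->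
  classical_sets.partition D (fun i => `[f i, f i + g i[%classic) `[0, c[%classic ->
  \sum_(i <- s) g i = c.
Proof.
move=> s_uniq -> c0 g0 [cover tI _]; apply: EFin_inj.
rewrite -[in RHS](lebesgue_measure_co 0 c0) add0r -cover.
rewrite /mu measure_fin_bigcup//=.
rewrite -fsbig_seq// -sumEFin; apply: eq_big_seq => i /g0 gi0.
by rewrite -/mu lebesgue_measure_co.
Qed.

Lemma measure_geometric_eq0 (X : set R) (z : R) : 0 <= z < 1 ->
  (forall r : nat, (mu X <= (z ^+ r)%:E)%E) -> mu X = 0%E.
Proof.
move=> /andP[z0 z1] Xz; apply/le_anti; rewrite measure_ge0 andbT.
apply/lee_addgt0Pr => e e0; rewrite add0e.
have zcvg : (fun r => z ^+ r) @ \oo --> (0 : R) by apply: cvg_expr; rewrite ger0_norm.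
have [r _ /(_ r (leqnn _)) zr] : \forall r \near \oo, z ^+ r < e.
  exact: (cvgr_lt _ zcvg).
by apply: le_trans (Xz r) _; rewrite lee_fin ltW.
Qed.

End HalfOpenIntervals.

(** * Widths of the towers *)

Section Widths.
Variables (R : realType) (A : finType) (S : A -> seq A) (K : nat).
Hypotheses (K_gt1 : (1 < K)%N) (SK : constant_length S K).
Variables (lambda : R) (w : A -> R) (Phi0 : A -> R) (phi : A * nat -> R).
Variable (ordT : A -> seq (A * nat)).
Hypothesis Phi0P : initial_choice w Phi0.
Hypothesis phiP : parent_choice S lambda w phi ordT.

Lemma parent_child p : (p.2 < K)%N -> parent_of S (child S p) p.
Proof. by move=> pK; rewrite /parent_of SK pK /child eqxx. Qed.

Let co_gt0 (a c : R) : `[a, a + c[%classic !=set0 -> 0 < c.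
Proof. by case=> x; rewrite /= in_itv /=; lra. Qed.

(** The blocks of a partition are nonempty, so their lengths are positive. *)
Lemma width_gt0 a : 0 < w a.
Proof. by have [_ _ /(_ a I)/co_gt0] := Phi0P. Qed.

Lemma scale_gt0 (a : A) : 0 < lambda.
Proof.
have [_ _ _ [_ _ ne]] := phiP (child S (a, 0%N)).
have /ne/co_gt0 : parent_of S (child S (a, 0%N)) (a, 0%N).
  by apply: (parent_child (p := (a, 0%N))); exact: ltnW.
by rewrite pmulr_rgt0 ?width_gt0// invr_gt0.
Qed.

Lemma sum_width : \sum_a w a = 1.
Proof.
apply: partition_width_sum Phi0P; rewrite ?ler01// ?index_enum_uniq//.
- by apply/seteqP; split=> a //= _; exact: mem_index_enum.
- by move=> a _; exact/ltW/width_gt0.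
Qed.

Lemma sum_parent_width a : \sum_(p <- ordT a) w p.1 / lambda = w a.
Proof.
have lambda_gt0 := scale_gt0 a.
have [ord_uniq ordE _ part] := phiP a.
apply: partition_width_sum part => //.
- by apply/seteqP; split=> p /=; rewrite ordE.
- exact/ltW/width_gt0.
- by move=> p _; rewrite divr_ge0// ltW// width_gt0.
Qed.

(** Summing w a over the letters a counts each w b / lambda once for each of the
K letters of S(b); as w has total mass 1, this gives 1 = K / lambda. *)
Lemma scale_eq_length : lambda = K%:R.
Proof.
have [a0 _|noA] := pickP (@predT A); last first.
  by have := sum_width; rewrite big_pred0// => /eqP; rewrite eq_sym oner_eq0.
have lambda_gt0 := scale_gt0 a0.
pose allp := [seq (b, j) | b <- index_enum A, j <- iota 0 K].
have allp_uniq : uniq allp.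
  apply: allpairs_uniq; rewrite ?index_enum_uniq ?iota_uniq//.
  by move=> [? ?] [? ?].
have mem_allp p : (p \in allp) = (p.2 < K)%N.
  apply/allpairsP/idP => [[[b j] /= [_ jK ->]]|pK].
    by rewrite mem_iota in jK.
  by exists p; rewrite mem_index_enum mem_iota; case: (p) pK.
have : \sum_a w a = \sum_(p <- allp) w p.1 / lambda.
  rewrite (partition_big (child S) xpredT)//; apply: eq_bigr => a _.
  rewrite -sum_parent_width -big_filter; apply: perm_big.
  have [ord_uniq ordE _ _] := phiP a.
  apply: uniq_perm => // [|p]; first exact: filter_uniq.
  by rewrite ordE mem_filter mem_allp unfold_in /parent_of SK andbC.
rewrite big_allpairs /=.
rewrite [X in _ = X -> _](eq_bigr (fun b => K%:R * (w b / lambda))); last first.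
  by move=> b _; rewrite big_const_seq count_predT size_iota iter_addr_0 mulr_natl.
rewrite -mulr_sumr -mulr_suml sum_width div1r => /esym K_lambda.
by have := congr1 ( *%R^~ lambda) K_lambda; rewrite divfK ?gt_eqF// mul1r => ->.
Qed.

End Widths.

(** * Cutting and stacking *)

Section TowerLevels.
Variables (R : realType) (A : finType) (S : A -> seq A) (K : nat).
Hypotheses (K_gt1 : (1 < K)%N) (SK : constant_length S K).
Variables (lambda : R) (w : A -> R) (Phi0 : A -> R) (phi : A * nat -> R).
Variable (ordT : A -> seq (A * nat)).
Hypothesis Phi0P : initial_choice w Phi0.
Hypothesis phiP : parent_choice S lambda w phi ordT.

Let w_gt0 : forall a, 0 < w a. Proof. exact: width_gt0 Phi0P. Qed.

Let lambdaK : lambda = K%:R.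
Proof. exact (scale_eq_length K_gt1 SK Phi0P phiP). Qed.

Let lambda_gt0 : 0 < lambda. Proof. by rewrite lambdaK ltr0n ltnW. Qed.

Let parent_child p : (p.2 < K)%N -> parent_of S (child S p) p.
Proof. exact: (parent_child SK). Qed.

(** The left endpoint of floor P of the level n tower of b. Unlike [Phi_fin] it
makes sense for n = 0, where the floors are the intervals of the initial
partition. *)
Fixpoint tower_base n (b : A) (P : nat) : R :=
  if n is n'.+1 then
    tower_base n' (child S (b, P %/ K ^ n')%N) (P %% K ^ n') +
    phi (b, P %/ K ^ n')%N / lambda ^+ n'
  else Phi0 b.

Definition tower_level n (b : A) (P : nat) : set R :=
  `[tower_base n b P, tower_base n b P + w b / lambda ^+ n[%classic.

Let expK_gt0 n : (0 < K ^ n)%N. Proof. by rewrite expn_gt0 ltnW. Qed.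
Hint Resolve expK_gt0 : core.

Let expl_gt0 n : 0 < lambda ^+ n. Proof. exact: exprn_gt0. Qed.
Hint Resolve expl_gt0 : core.

Lemma tower_baseS n b P : tower_base n.+1 b P =
  tower_base n (child S (b, P %/ K ^ n)%N) (P %% K ^ n) +
  phi (b, P %/ K ^ n)%N / lambda ^+ n.
Proof. by []. Qed.

Lemma Phi_fin_rcons s p : s != [::] ->
  Phi_fin S lambda Phi0 phi (rcons s p) =
  Phi_fin S lambda Phi0 phi s + phi p / lambda ^+ size s.
Proof.
case: s => // q s _; rewrite rcons_cons /Phi_fin -rcons_cons size_rcons.
rewrite big_ord_recr /= addrA nth_rcons ltnn eqxx; congr (_ + _ + _).
apply: eq_bigr => k _; rewrite -rcons_cons nth_rcons.
by rewrite [size _]/= ltn_ord.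
Qed.

Lemma Phi_fin_tower n b P :
  Phi_fin S lambda Phi0 phi (tower_address S K n.+1 b P) = tower_base n.+1 b P.
Proof.
elim: n b P => [|n IHn] b P.
  by rewrite /Phi_fin /= big_ord_recl big_ord0 addr0.
rewrite tower_addressS Phi_fin_rcons ?size_tower_address ?IHn//.
by rewrite -size_eq0 size_tower_address.
Qed.

Lemma address_interval_tower n b P :
  address_interval S lambda w Phi0 phi (tower_address S K n.+1 b P) =
  tower_level n.+1 b P.
Proof.
have address_interval_rcons s p : address_interval S lambda w Phi0 phi (rcons s p) =
    `[Phi_fin S lambda Phi0 phi (rcons s p),
      Phi_fin S lambda Phi0 phi (rcons s p) + w p.1 / lambda ^+ (size s).+1[%classic.
  by case: s => //= q s; rewrite last_rcons size_rcons.
rewrite /tower_level -Phi_fin_tower tower_addressS address_interval_rcons.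
by rewrite size_tower_address.
Qed.

Lemma parent_lt a p : parent_of S a p -> (p.2 < K)%N.
Proof. by rewrite /parent_of SK => /andP[]. Qed.

Lemma child_parent a p : parent_of S a p -> child S p = a.
Proof. by move=> /andP[_ /eqP]. Qed.

(** The slice of the tower of a parent p stays within the floor it is cut from. *)
Lemma phi_itv p y : (p.2 < K)%N -> phi p <= y < phi p + w p.1 / lambda ->
  0 <= y < w (child S p).
Proof.
move=> /parent_child pp yp.
have [_ _ _ [cover _ _]] := phiP (child S p).
have : `[0, w (child S p)[%classic y.
  by rewrite -cover; exists p => //=; rewrite in_itv.
by rewrite /= in_itv.
Qed.

(** The two rescalings below send a level n floor of a letter a onto [0, w a[,
so that its slices become the intervals of the partition given by phi. *)
Lemma tower_level_phi n b P x : tower_level n.+1 b P x <->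
  phi (b, P %/ K ^ n)%N <=
    (x - tower_base n (child S (b, P %/ K ^ n)%N) (P %% K ^ n)) * lambda ^+ n
  < phi (b, P %/ K ^ n)%N + w b / lambda.
Proof.
rewrite /tower_level /= in_itv /=; set c := tower_base n _ _.
rewrite -ler_pdivrMr// -ltr_pdivlMr// mulrDl lerBrDl ltrBlDl addrA.
by rewrite exprSr invfM mulrAC mulrA.
Qed.

Lemma tower_level_offset n b P x : tower_level n b P x <->
  0 <= (x - tower_base n b P) * lambda ^+ n < w b.
Proof.
rewrite /tower_level /= in_itv /=.
by rewrite -ler_pdivrMr// -ltr_pdivlMr// mul0r subr_ge0 ltrBlDl.
Qed.

Lemma tower_level_down n b P x : (P < K ^ n.+1)%N -> tower_level n.+1 b P x ->
  tower_level n (child S (b, P %/ K ^ n)%N) (P %% K ^ n) x.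
Proof.
move=> /(top_digit_lt K_gt1) dK /tower_level_phi xP.
by apply/tower_level_offset; exact: phi_itv xP.
Qed.

Lemma tower_level_up n a P x : (P < K ^ n)%N -> tower_level n a P x ->
  exists2 p, parent_of S a p & tower_level n.+1 p.1 (p.2 * K ^ n + P) x.
Proof.
move=> PK /tower_level_offset xP; have [_ _ _ [cover _ _]] := phiP a.
have : `[0, w a[%classic ((x - tower_base n a P) * lambda ^+ n).
  by rewrite /= in_itv.
rewrite -cover => -[p /= pa]; rewrite in_itv /= => xp; exists p => //.
apply/tower_level_phi; rewrite divnMDl// divn_small// addn0 modnMDl.
by rewrite modn_small// -surjective_pairing (child_parent pa).
Qed.

Lemma tower_level_inj n a a' P P' x : (P < K ^ n)%N -> (P' < K ^ n)%N ->
  tower_level n a P x -> tower_level n a' P' x -> a = a' /\ P = P'.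
Proof.
elim: n a a' P P' => [|n IHn] a a' P P' PK P'K xP xP'.
  move: PK P'K; rewrite expn0 !ltnS !leqn0 => /eqP P0 /eqP P'0; subst P P'.
  split=> //; have [_ tI _] := Phi0P; apply: tI => //; exists x.
  by move: xP xP'; rewrite /tower_level /= expr0 !divr1.
have [cE PE] : child S (a, P %/ K ^ n)%N = child S (a', P' %/ K ^ n)%N /\
    (P %% K ^ n = P' %% K ^ n)%N.
  by apply: IHn; rewrite ?ltn_mod//; exact: tower_level_down.
move: xP xP' => /tower_level_phi xP /tower_level_phi.
rewrite -cE -PE => xP'.
have [_ _ _ [_ tI _]] := phiP (child S (a, P %/ K ^ n)%N).
have [] : (a, P %/ K ^ n)%N = (a', P' %/ K ^ n)%N.
  apply: tI => /=.
  - apply: parent_child; exact: (top_digit_lt K_gt1 PK).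
  - by rewrite cE; apply: parent_child; exact: (top_digit_lt K_gt1 P'K).
  - by eexists; split; rewrite /= in_itv /=; [exact: xP|exact: xP'].
by move=> -> dE; rewrite (divn_eq P (K ^ n)) dE PE -divn_eq.
Qed.

Lemma tower_level_cover n x : `[0, 1[%classic x ->
  exists2 p : A * nat, (p.2 < K ^ n)%N & tower_level n p.1 p.2 x.
Proof.
elim: n => [|n IHn] x01.
  have [cover _ _] := Phi0P; move: x01; rewrite -cover => -[a _ xa].
  by exists (a, 0%N) => //; move: xa; rewrite /tower_level /= expr0 divr1.
have [[a P] /= PK /(tower_level_up PK)[p pa xp]] := IHn x01.
exists (p.1, (p.2 * K ^ n + P)%N) => //=.
by have := parent_lt pa; rewrite expnS; nia.
Qed.

Lemma tower_level_sub01 n b P : (P < K ^ n)%N ->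
  tower_level n b P `<=` `[0, 1[.
Proof.
elim: n b P => [|n IHn] b P PK x.
  move=> xb; have [cover _ _] := Phi0P; rewrite -cover; exists b => //.
  by move: xb; rewrite /tower_level /= expr0 divr1.
by move/(tower_level_down PK); apply: IHn; rewrite ltn_mod.
Qed.

(** Floor P of a level n + m tower lies in the level m tower indexed by the
letter at position P / K^m of S^n(b), at the height given by the m lowest
digits of P. *)
Lemma tower_level_comp n m b P x : (P < K ^ (n + m))%N ->
  tower_level (n + m) b P x ->
  tower_level m (letter S K n b (P %/ K ^ m)) (P %% K ^ m) x.
Proof.
elim: n b P => [|n IHn] b P PK; first by rewrite modn_small.
move=> /(tower_level_down PK)/IHn; rewrite ltn_mod => /(_ (expK_gt0 _)).
rewrite letterS modn_dvdm ?expnD ?dvdn_mull// divnMA modn_divl.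
by rewrite -!divnMA [(K ^ m * _)%N]mulnC.
Qed.

(** Climbing one floor in a tower adds to the left endpoint the same quantity as
the adic successor does at the first digit that is not maximal. If the carry
stops below level n, then the common leading digit contributes the same amount
to both endpoints; otherwise the successor is computed on the whole address. *)
Lemma adic_succ_step p0 n b P (s := tower_address S K n b P) :
  (P.+1 < K ^ n)%N ->
  exists N, [/\ (0 < N <= n)%N, not_last S (nth p0 s N.-1),
    forall k, (k < N.-1)%N -> ~~ not_last S (nth p0 s k) &
    Phi_fin S lambda Phi0 phi (adic_succ S (take N s)) -
    Phi_fin S lambda Phi0 phi (take N s) =
    tower_base n b P.+1 - tower_base n b P].
Proof.
rewrite {}/s; elim: n b P => [|n IHn] b P PK; first by rewrite ltnNge expn0 in PK.
have [j [r [PE r_lt jE rE]]] : exists j r, [/\ P = (j * K ^ n + r)%N,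
    (r < K ^ n)%N, (P %/ K ^ n = j)%N & (P %% K ^ n = r)%N].
  exists (P %/ K ^ n)%N, (P %% K ^ n)%N; rewrite ltn_mod.
  by split => //; exact: divn_eq.
case: (ltnP r.+1 (K ^ n)) => [rK|Kr].
  have [N [/andP[N_gt0 Nn] nlN lastN PhiE]] := IHn (child S (b, j)) r rK.
  have szt := size_tower_address S K n (child S (b, j)) r.
  exists N; rewrite tower_addressS jE rE N_gt0 (leq_trans Nn)//; split => //.
  - by rewrite nth_rcons szt prednK// Nn.
  - by move=> k kN; rewrite nth_rcons szt ifT ?lastN//; lia.
  rewrite -cats1 takel_cat ?szt// PhiE !tower_baseS.
  have -> : (P.+1 %/ K ^ n = j)%N.
    by rewrite PE -addnS divnMDl// divn_small ?addn0.
  have -> : (P.+1 %% K ^ n = r.+1)%N by rewrite PE -addnS modnMDl modn_small.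
  by rewrite jE rE; ring.
have rT : r = (K ^ n).-1 by apply/eqP; rewrite -eqSS prednK// eqn_leq r_lt Kr.
have jK : (j.+1 < K)%N.
  have : (P.+1 < K ^ n.+1)%N by [].
  by rewrite PE rT -addnS prednK// -mulSnr expnS ltn_pmul2r.
have PSE : P.+1 = (j.+1 * K ^ n)%N by rewrite PE rT -addnS prednK// mulSnr.
have szt := size_tower_address S K n (child S (b, j)) r.
exists n.+1; rewrite ltnS leqnn tower_addressS jE rE; split => //=.
- by rewrite nth_rcons szt ltnn eqxx /not_last /= SK; lia.
- move=> k kn; rewrite nth_rcons szt kn.
  have rS : r.+1 = (K ^ n)%N by rewrite rT prednK.
  have /allP lastT := all_last_tower_address K_gt1 SK (child S (b, j)) rS.
  by apply: (lastT (nth p0 _ k)); rewrite mem_nth ?szt.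
rewrite take_oversize ?size_rcons ?szt//.
have -> : rcons (tower_address S K n (child S (b, j)) r) (b, j) =
    tower_address S K n.+1 b P by rewrite tower_addressS jE rE.
rewrite {1}PE rT (adic_succ_tower_address K_gt1 SK)// -PSE !Phi_fin_tower.
by rewrite !tower_baseS.
Qed.

(** The floors containing x at the successive levels are nested, since at each
level there is only one of them; their addresses are therefore the prefixes of
one infinite address. *)
Lemma tower_address_point n b P x : (P < K ^ n)%N -> tower_level n b P x ->
  exists a, address_of_point S lambda w Phi0 phi x a /\
    mkseq a n = tower_address S K n b P.
Proof.
move=> PK xP; have x01 := tower_level_sub01 PK xP.
have [loc locP] : exists loc : nat -> A * nat, forall m,
    ((loc m).2 < K ^ m)%N /\ tower_level m (loc m).1 (loc m).2 x.
  have loc m : {p : A * nat | (p.2 < K ^ m)%N /\ tower_level m p.1 p.2 x}.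
    by apply: cid; have [p] := tower_level_cover m x01; exists p.
  by exists (fun m => sval (loc m)) => m; case: (loc m).
pose a k := ((loc k.+1).1, (loc k.+1).2 %/ K ^ k)%N.
have locS m : child S (a m) = (loc m).1 /\
    ((loc m.+1).2 %% K ^ m)%N = (loc m).2.
  apply: (@tower_level_inj m _ _ _ _ x); rewrite ?ltn_mod//.
  - exact: (locP m).1.
  - by apply: tower_level_down; [exact: (locP _).1|exact: (locP _).2].
  - exact: (locP m).2.
have aE m : mkseq a m = tower_address S K m (loc m).1 (loc m).2.
  elim: m => // m IHm; rewrite mkseqS IHm tower_addressS.
  by case: (locS m) => <- ->.
have aK k : ((a k).2 < K)%N by exact: (top_digit_lt K_gt1 (locP k.+1).1).
exists a; split; last first.
  by rewrite aE; have [-> ->] := tower_level_inj (locP n).1 PK (locP n).2 xP.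
move=> [//|m] _; split; last first.
  by rewrite aE address_interval_tower; exact: (locP _).2.
apply/andP; split; first by apply/allP => _ /mapP[k _ ->]; rewrite SK.
apply/(sortedP (b, 0%N)) => i; rewrite size_mkseq => im.
rewrite !nth_mkseq//; last exact: ltnW.
by have /= <- := (locS i.+1).1; exact: parent_child.
Qed.

(** * The interval exchange on the towers *)

Section Exchange.
Variable F : R -> R.
Hypothesis FP : infinite_iet S lambda w Phi0 phi F.

Lemma iet_tower_level n b P x : (P.+1 < K ^ n)%N -> tower_level n b P x ->
  tower_level n b P.+1 (F x).
Proof.
move=> PK xP; have [a [xa aE]] := tower_address_point (ltnW PK) xP.
have [N [/andP[N_gt0 Nn] nlN lastN PhiE]] := adic_succ_step (b, 0%N) b PK.
have x01 : x \in `[0, 1[ := tower_level_sub01 (ltnW PK) xP.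
have nthE k : (k < n)%N -> nth (b, 0%N) (tower_address S K n b P) k = a k.
  by move=> kn; rewrite -aE nth_mkseq.
have takeE : take N (tower_address S K n b P) = mkseq a N.
  by rewrite -aE -map_take take_iota (minn_idPl Nn).
have -> : F x = x + (tower_base n b P.+1 - tower_base n b P).
  rewrite -PhiE takeE (@FP x a N)//; first by ring.
  split=> //; first by rewrite -nthE// prednK.
  by move=> k kN; rewrite -nthE; [exact: lastN|lia].
by move: xP; rewrite /tower_level /= !in_itv /=; lra.
Qed.

Lemma iter_iet_tower_level i n b P x : (P + i < K ^ n)%N ->
  tower_level n b P x -> tower_level n b (P + i) (iter i F x).
Proof.
elim: i => [|i IHi]; first by rewrite addn0.
by rewrite addnS => PK xP; apply: iet_tower_level => //; exact/IHi/xP/ltnW.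
Qed.

Local Notation mu := (@lebesgue_measure R).

Lemma lebesgue_tower_level n b P :
  mu (tower_level n b P) = (w b / lambda ^+ n)%:E.
Proof. by rewrite lebesgue_measure_co// divr_ge0// ltW. Qed.

Lemma measurable_tower_level n b P :
  measurable (tower_level n b P : set (measurableTypeR R)).
Proof. exact: measurable_itv. Qed.

Lemma tower_level_dist n b P x y : tower_level n b P x -> tower_level n b P y ->
  `|x - y| < w b / lambda ^+ n.
Proof. by rewrite /tower_level /= !in_itv /= ltr_norml; lra. Qed.

(** * From coincidence to convergence *)

(** The base-K digits m, ..., m + N - 1 of the height of x spell jc. *)
Definition window_at (N jc m : nat) (x : R) : Prop :=
  exists b P, [/\ (P < K ^ (m + N))%N, tower_level (m + N) b P x &
    (P %/ K ^ m = jc)%N].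

Section Recurrence.
Variables (N jc : nat).
Hypothesis jcN : (jc < K ^ N)%N.

(** The heights at level m + r N none of whose r windows of N digits, starting at
digit m, spells jc. *)
Fixpoint avoiding_positions (m r : nat) : seq nat :=
  if r is r'.+1 then
    [seq (q * K ^ (m + r' * N) + P)%N |
       q <- rem jc (iota 0 (K ^ N)), P <- avoiding_positions m r']
  else iota 0 (K ^ m).

Lemma size_avoiding_positions m r :
  size (avoiding_positions m r) = (K ^ m * (K ^ N).-1 ^ r)%N.
Proof.
elim: r => [|r IHr] /=; first by rewrite size_iota muln1.
rewrite size_allpairs size_rem ?mem_iota// size_iota IHr expnS.
by rewrite mulnCA.
Qed.

Lemma mem_avoiding_positions m r b P x :
  (forall k, (m <= k)%N -> ~ window_at N jc k x) ->
  (P < K ^ (m + r * N))%N -> tower_level (m + r * N) b P x ->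
  P \in avoiding_positions m r.
Proof.
move=> xm; elim: r b P => [|r IHr] b P; first by rewrite addn0 mem_iota.
set k := (m + r * N)%N; have -> : (m + r.+1 * N = k + N)%N by rewrite /k; lia.
move=> PK xP; apply/allpairsP; exists (P %/ K ^ k, P %% K ^ k)%N; split => /=.
- rewrite mem_rem_uniq ?iota_uniq// inE mem_iota /= add0n.
  rewrite ltn_divLR// -expnD addnC PK andbT; apply/eqP => Pjc.
  by apply: (xm k); [rewrite /k; lia|exists b, P].
- apply: (IHr (letter S K N b (P %/ K ^ k))); first by rewrite ltn_mod.
  by apply: tower_level_comp; rewrite addnC.
- exact: divn_eq.
Qed.

(** After r windows the points left are covered by a proportion
((K^N - 1) / K^N)^r of the floors. *)
Lemma negligible_no_window m :
  mu.-negligible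
    [set x | `[0, 1[%classic x /\ forall k, (m <= k)%N -> ~ window_at N jc k x].
Proof.
pose C r : set (measurableTypeR R) :=
  \big[setU/set0]_(p <- [seq (b, P) | b <- index_enum A,
    P <- avoiding_positions m r]) tower_level (m + r * N) p.1 p.2.
have mC r : measurable (C r).
  by apply: bigsetU_measurable => p _; exact: measurable_tower_level.
exists (\bigcap_r C r); split.
- exact: bigcap_measurable.
- pose z : R := (K ^ N).-1%:R / (K ^ N)%:R.
  have z01 : 0 <= z < 1.
    by rewrite divr_ge0//= ltr_pdivrMr ?ltr0n// mul1r ltr_nat ltn_predL.
  apply: (measure_geometric_eq0 z01) => r.
  apply: (@le_trans _ _ (mu (C r))).
    by apply: le_measure; rewrite ?inE//; [exact: bigcap_measurable|exact: bigcap_inf].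
  apply: le_trans (measure_bigsetU_seq_le _ _ _) _.
    by move=> p; exact: measurable_tower_level.
  rewrite (eq_bigr (fun p => (w p.1 / lambda ^+ (m + r * N))%:E)); last first.
    by move=> p _; exact: lebesgue_tower_level.
  rewrite sumEFin lee_fin big_allpairs /=.
  under eq_bigr do rewrite big_const_seq count_predT iter_addr_0
    size_avoiding_positions.
  rewrite sumrMnl -mulr_suml (sum_width Phi0P) mul1r -mulr_natr natrM !natrX.
  rewrite lambdaK exprD mulnC exprM -(natrX _ K N) invfM mulrACA.
  rewrite mulVf; last by rewrite expf_neq0// pnatr_eq0 -lt0n ltnW.
  by rewrite mul1r mulrC -expr_div_n.
- move=> x [x01 xm] r _; rewrite /C -bigcup_seq.
  have [[b P] /= PK xP] := tower_level_cover (m + r * N) x01.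
  exists (b, P) => //=; apply/allpairsP; exists (b, P).
  by rewrite mem_index_enum (mem_avoiding_positions xm PK xP).
Qed.

End Recurrence.

Section Return.
Variables (N jc : nat) (c : A).
Hypothesis letter_jc : forall a, letter S K N a jc = c.
(* As jc is not the last position, a point whose digits from M on spell jc has
   at least K^M floors above it. *)
Hypothesis jcN2 : (jc.+2 <= K ^ N)%N.

(** The window at m forces the level m tower of c, both for x and for its image.
The later window at M only guarantees that the orbit of x up to time K^n climbs
inside one tower, so that the image of x is known. *)
Lemma window_same_level m x n :
  window_at N jc m x -> (exists2 M, (n <= M)%N & window_at N jc M x) ->
  (m + N <= n)%N ->
  exists P, tower_level m c P x /\ tower_level m c P (iter (K ^ n) F x).
Proof.
move=> [b [P [PK xP Pjc]]] [M nM [b' [P' [P'K xP' P'jc]]]] mn.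
have P'nK : (P' + K ^ n < K ^ (M + N))%N.
  have : (K ^ n <= K ^ M)%N by rewrite leq_exp2l.
  have : (P' < jc.+1 * K ^ M)%N by rewrite -P'jc ltn_ceil.
  have : (jc.+2 * K ^ M <= K ^ (M + N))%N by rewrite expnD mulnC leq_mul2l jcN2 orbT.
  rewrite !mulSn; lia.
have yP' := iter_iet_tower_level P'nK xP'.
have MN : (M + N = M - m + (m + N))%N by lia.
rewrite MN in P'K P'nK xP' yP'.
have modE : ((P' + K ^ n) %% K ^ (m + N) = P' %% K ^ (m + N))%N.
  by rewrite -modnDmr (eqP (dvdn_exp2l K mn)) addn0.
have {}xP' := tower_level_comp P'K xP'.
have := tower_level_comp P'nK yP'; rewrite modE => {}yP'.
have P'_lt : (P' %% K ^ (m + N) < K ^ (m + N))%N by rewrite ltn_mod.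
have [_ PE] := tower_level_inj P'_lt PK xP' xP.
exists (P %% K ^ m)%N; rewrite PE in xP' yP'.
rewrite addnC in xP' yP' PK.
by split; [move: xP'|move: yP'] => /(tower_level_comp PK); rewrite Pjc letter_jc.
Qed.

Lemma iet_power_cvg x : (forall m, exists2 k, (m <= k)%N & window_at N jc k x) ->
  (fun n => iter (K ^ n) F x) @ \oo --> x.
Proof.
move=> win; apply/cvgrPdist_lt => e e0.
have [m0 small] : exists m0, forall m, (m0 <= m)%N -> w c / lambda ^+ m < e.
  have pow_cvg : (fun m => lambda^-1 ^+ m) @ \oo --> (0 : R).
    apply: cvg_expr; rewrite ger0_norm ?invr_ge0 1?ltW// invf_lt1//.
    by rewrite lambdaK ltr1n.
  have [m0 _ m0P] : \forall m \near \oo, lambda^-1 ^+ m < e / w c.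
    by apply: (cvgr_lt _ pow_cvg); rewrite divr_gt0.
  by exists m0 => m /m0P /=; rewrite exprVn ltr_pdivlMr// mulrC.
have [m m0m xm] := win m0.
exists (m + N)%N => // n /= mn.
have [P [xP yP]] := window_same_level xm (win n) mn.
exact: lt_trans (tower_level_dist xP yP) (small _ m0m).
Qed.

End Return.

Lemma coincidence_ae_cvg : has_coincidence S K ->
  {ae mu, forall x : R, x \in `[0, 1] ->
     (fun n => iter (K ^ n) F x) @ \oo --> x}.
Proof.
move=> [N [c [jc [jcN coin]]]].
(* One more iteration of S keeps the coinciding position jc, now with leading
   digit 0, hence away from the last position. *)
have jcN1 : (jc.+2 <= K ^ N.+1)%N.
  by rewrite expnS; have := leq_mul2r (K ^ N) 2 K; rewrite K_gt1 orbT; lia.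
have letter_jc a : letter S K N.+1 a jc = c.
  rewrite letterS divn_small// modn_small//.
  by rewrite -(nth_subst_iter K_gt1 SK (child S (a, 0%N)))// coin.
have null_end : mu.-negligible [set (1 : R)].
  by apply/negligibleP; [exact: measurable_set1|exact: lebesgue_measure_set1].
have null_window := negligible_bigcup (negligible_no_window (ltnW jcN1)).
apply: negligibleS (negligibleU null_end null_window) => x /= /not_implyP[x01 ncvg].
have [->|x1] := eqVneq x 1; [by left|right].
apply: contrapT => nwin; apply: ncvg; apply: (iet_power_cvg letter_jc jcN1) => m.
apply: contrapT => nm; apply: nwin; exists m => //=; split.
  by move: x01; rewrite !in_itv /= => /andP[-> xle]; rewrite lt_neqAle x1.
by move=> k mk xk; apply: nm; exists k.
Qed.

(** * From convergence to coincidence *)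

Lemma tower_level_letter n b P x : (P < K ^ n)%N -> tower_level n b P x ->
  tower_level 0 (letter S K n b P) 0 x.
Proof.
by have := @tower_level_comp n 0 b P x; rewrite addn0 expn0 divn1 modn1.
Qed.

(** K^n floors above, the level n letter is the next letter of S^m(b) and the
height r at level n is the same. *)
Lemma iet_power_letters m n b P r x : (P.+1 < K ^ m)%N -> (r < K ^ n)%N ->
  tower_level (m + n) b (P * K ^ n + r) x ->
  tower_level 0 (letter S K n (letter S K m b P) r) 0 x /\
  tower_level 0 (letter S K n (letter S K m b P.+1) r) 0 (iter (K ^ n) F x).
Proof.
move=> PK rK xP.
have PS : (P * K ^ n + r + K ^ n = P.+1 * K ^ n + r)%N by rewrite mulSnr addnAC.
have PSK : (P.+1 * K ^ n + r < K ^ (m + n))%N.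
  have : (P.+2 * K ^ n <= K ^ (m + n))%N by rewrite expnD leq_mul2r PK orbT.
  by rewrite [(P.+2 * _)%N]mulSnr; lia.
have PrK : (P * K ^ n + r < K ^ (m + n))%N by rewrite mulSn in PSK; lia.
have yP : tower_level (m + n) b (P.+1 * K ^ n + r) (iter (K ^ n) F x).
  by rewrite -PS; apply: iter_iet_tower_level => //; rewrite PS.
have := tower_level_comp PSK yP; have := tower_level_comp PrK xP.
rewrite !divnMDl// divn_small// !addn0 !modnMDl modn_small//.
by move=> /(tower_level_letter rK) ? /(tower_level_letter rK).
Qed.

Lemma negligible_left_ends : mu.-negligible [set Phi0 a | a in [set: A]].
Proof.
have ends_countable : countable [set Phi0 a | a in [set: A]].
  by apply: finite_set_countable; exact: finite_image.
apply/negligibleP; last exact: countable_lebesgue_measure0.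
by apply: countable_measurable => // t; exact: measurable_set1.
Qed.

Lemma near_initial_level a x (u : nat -> R) : x <> Phi0 a ->
  tower_level 0 a 0 x -> u @ \oo --> x ->
  \forall n \near \oo, tower_level 0 a 0 (u n).
Proof.
rewrite /tower_level /= in_itv /= expr0 divr1 => xa /andP[ax xaw] ux.
have {}ax : Phi0 a < x by rewrite lt_neqAle ax andbT; apply/eqP => /esym.
near=> n; rewrite in_itv /=; apply/andP; split.
  by apply: ltW; near: n; exact: (cvgr_gt _ ux).
by near: n; exact: (cvgr_lt _ ux).
Unshelve. all: by end_near.
Qed.

Lemma ae_cvg_coincidence (m : nat) (b0 : A) :
  (forall a, a \in subst_iter S m b0) ->
  {ae mu, forall x : R, x \in `[0, 1] ->
     (fun n => iter (K ^ n) F x) @ \oo --> x} ->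
  has_coincidence S K.
Proof.
move=> b0m ae_cvg; apply: contrapT => no_coin.
have [p pP] : exists p : nat -> nat -> nat, forall n r, (r < K ^ n)%N ->
    ((p n r).+1 < K ^ m)%N /\ letter S K n (letter S K m b0 (p n r)) r <>
      letter S K n (letter S K m b0 (p n r).+1) r.
  have pair n r : {P | (r < K ^ n)%N -> (P.+1 < K ^ m)%N /\
      letter S K n (letter S K m b0 P) r <>
      letter S K n (letter S K m b0 P.+1) r}.
    apply: cid; have [rK|_] := ltnP r (K ^ n); last by exists 0%N.
    have [P PK neq] := no_coincidence_pair K_gt1 SK b0m no_coin rK.
    by exists P.
  by exists (fun n r => sval (pair n r)) => n r; exact: (svalP (pair n r)).
have pK n r : (r < K ^ n)%N -> (p n r * K ^ n + r < K ^ (m + n))%N.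
  move=> rK; have [PK _] := pP n r rK.
  have : ((p n r).+1 * K ^ n <= K ^ (m + n))%N.
    by rewrite expnD leq_mul2r ltnW ?orbT.
  by rewrite mulSn; lia.
pose U n : set (measurableTypeR R) :=
  \bigcup_(r in `I_(K ^ n)) tower_level (m + n) b0 (p n r * K ^ n + r).
have U01 n : U n `<=` `[0, 1[.
  by move=> x [r /= rK xr]; exact: tower_level_sub01 (pK _ _ rK) _ xr.
have mU n : measurable (U n).
  by apply: bigcup_measurable => r _; exact: measurable_tower_level.
have muU n : mu (U n) = (w b0 / lambda ^+ m)%:E.
  have tU : trivIset `I_(K ^ n)
      (fun r => tower_level (m + n) b0 (p n r * K ^ n + r)).
    move=> r r' /= rK r'K [x [xr xr']].
    have [_ /(congr1 (modn^~ (K ^ n)%N))] :=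
      tower_level_inj (pK _ _ rK) (pK _ _ r'K) xr xr'.
    by rewrite /= !modnMDl !modn_small.
  rewrite /U measure_fin_bigcup//; last first.
    by move=> r _; exact: measurable_tower_level.
  rewrite -fsbig_ord (eq_bigr (fun=> (w b0 / lambda ^+ (m + n))%:E)); last first.
    by move=> r _; exact: lebesgue_tower_level.
  rewrite sumEFin big_const_ord iter_addr_0; congr (_%:E).
  by rewrite -mulr_natr natrX -lambdaK exprD invfM mulrA mulfVK ?gt_eqF.
have Ufin : (mu (\bigcup_(k >= 0) U k) < +oo)%E.
  apply: (@le_lt_trans _ _ (mu `[0 : R, 0 + 1[%classic)).
    apply: le_measure; rewrite ?inE//; first exact: bigcup_measurable.
    by move=> x [k _ /U01]; rewrite add0r.
  by rewrite lebesgue_measure_co ?ltry.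
have limU : ((w b0 / lambda ^+ m)%:E <= mu (lim_sup_set U))%E.
  by apply: lim_sup_set_ge => // n; rewrite -(muU n).
have nullU : mu.-negligible (lim_sup_set U).
  apply: negligibleS (negligibleU ae_cvg negligible_left_ends) => x xU.
  apply: contrapT => /not_orP[/contrapT x_cvg x_end].
  have x01 : `[0, 1[%classic x by have [k _ /U01] := xU 0%N I.
  have /x_cvg {}x_cvg : x \in `[0, 1].
    by move: x01; rewrite /= !in_itv /= => /andP[-> /ltW].
  have [[a P] /=] := tower_level_cover 0 x01.
  rewrite expn0 ltnS leqn0 => /eqP -> xa.
  have x_ne : x <> Phi0 a by move=> xE; apply: x_end; exists a.
  have [n0 _ near_x] := near_initial_level x_ne xa x_cvg.
  have [k /= kn [r /= rK xr]] := xU n0 I; have [PK neq] := pP k r rK.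
  have [xk yk] := iet_power_letters PK rK xr.
  have lt01 : (0 < K ^ 0)%N by [].
  have [aE _] := tower_level_inj lt01 lt01 xa xk.
  have [aE' _] := tower_level_inj lt01 lt01 (near_x _ kn) yk.
  by apply: neq; rewrite -aE -aE'.
have : (mu (lim_sup_set U) <= 0)%E.
  rewrite (measure_negligible _ nullU)//.
  by apply: bigcap_measurable => // k _; exact: bigcup_measurable.
by move=> /(le_trans limU); rewrite lee_fin leNgt divr_gt0.
Qed.

End Exchange.
End TowerLevels.

Theorem theorem5p3 (R : realType) (A : finType) (S : A -> seq A) (K : nat)
    (lambda : R) (t0 : subshift_type S)
    (mu : probability (borel_subshift t0) R)
    (Phi0 : A -> R) (ordT : A -> seq (A * nat)) (phi : A * nat -> R)
    (Phi : subshift_type S -> R) (F : R -> R) :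
  (1 < K)%N ->
  constant_length S K ->
  primitive S ->
  recognizable S ->
  perron_frobenius_eigenvalue S lambda ->
  shift_invariant mu ->
  initial_choice (letter_measure mu) Phi0 ->
  parent_choice S lambda (letter_measure mu) phi ordT ->
  canonical_isomorphism lambda Phi0 phi Phi ->
  infinite_iet S lambda (letter_measure mu) Phi0 phi F ->
  {ae @lebesgue_measure R, forall x : R, x \in `[0, 1] ->
     (fun n => iter (K ^ n) F x) @ \oo --> x}
  <-> has_coincidence S K.
Proof.
move=> K_gt1 SK S_primitive _ _ _ Phi0P phiP _ FP; split; last first.
  exact: (coincidence_ae_cvg K_gt1 SK Phi0P phiP FP).
have [m lettersE] := primitive_word (set_val t0 0) S_primitive.
exact: (ae_cvg_coincidence K_gt1 SK Phi0P phiP FP lettersE).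
Qed.
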